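(* Let $S$ be a solenoid. Then the Cartesian product $[0,1]\times S$ has the fupcon property; that is, for every continuum $M\subseteq [0,1]\times S$ with $\pi_{[0,1]}(M)=[0,1]$ and $\pi_S(M)=S$, and for every open set $U\subseteq [0,1]\times S$ with $M\subseteq U$, there exists an open connected set $V$ with $M\subseteq V\subseteq U$.
   Context: A continuum is a nonempty compact connected Hausdorff space (here metric). A solenoid is a continuum homeomorphic to an inverse limit $\varprojlim\{\mathbb{S}^1, f_i\}$ of unit circles $\mathbb{S}^1\subseteq\mathbb{C}$ with bonding maps $f_i(z)=z^{n_i}$, where each $n_i\geq 2$ is an integer. For a product $X\times Y$ of continua, $\pi_X,\pi_Y$ denote the coordinate projections. $X\times Y$ has the fupcon property if every subcontinuum $M\subseteq X\times Y$ with full projections ($\pi_X(M)=X$ and $\pi_Y(M)=Y$) has arbitrarily small open connected neighborhoods, i.e. for every open $U\supseteq M$ there is an open connected $V$ with $M\subseteq V\subseteq U$. *)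

(* Defs.v *)
From HB Require Import structures.
From mathcomp Require Import all_boot all_order all_algebra.
From mathcomp Require Import all_classical all_reals all_analysis.
Set Implicit Arguments. Unset Strict Implicit. Unset Printing Implicit Defensive.
Import Order.TTheory GRing.Theory Num.Theory.
Import numFieldTopology.Exports numFieldNormedType.Exports.
Local Open Scope classical_set_scope.
Local Open Scope ring_scope.

(* Complex numbers are represented as pairs (re, im) in R * R (with the
   product topology = the usual topology of C = R^2). *)
Definition cmul (R : realType) (z w : R * R) : R * R :=
  (z.1 * w.1 - z.2 * w.2, z.1 * w.2 + z.2 * w.1).

Definition cpow (R : realType) (z : R * R) (k : nat) : R * R :=
  iter k (cmul z) (1, 0).

Definition circle (R : realType) : set (R * R) :=
  [set z | z.1 ^+ 2 + z.2 ^+ 2 = 1].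

Definition solenoid_invlim (R : realType) (n : nat -> nat)
  : set {ptws nat -> (R * R)%type} :=
  [set z | forall i, circle (z i) /\ z i = cpow (z i.+1) (n i)].

Definition homeomorphic_sets (T U : topologicalType) (S : set T) (L : set U) :=
  exists (f : T -> U) (g : U -> T),
    [/\ {within S, continuous f}, {within L, continuous g},
        f @` S `<=` L, g @` L `<=` S &
        (forall x, S x -> g (f x) = x) /\ (forall y, L y -> f (g y) = y)].

Definition is_solenoid (R : realType) (T : topologicalType) (S : set T) :=
  exists n : nat -> nat, (forall i, (2 <= n i)%N) /\
    homeomorphic_sets S (@solenoid_invlim R n).

Definition open_in (T : topologicalType) (X U : set T) :=
  exists W, open W /\ U = X `&` W.

(* continuum (in a Hausdorff ambient space): nonempty compact connected set *)
Definition continuum (T : topologicalType) (M : set T) :=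
  [/\ M !=set0, compact M & connected M].

Definition fupcon (T1 T2 : topologicalType) (X : set T1) (Y : set T2) :=
  forall M : set (T1 * T2)%type,
    M `<=` X `*` Y -> continuum M -> fst @` M = X -> snd @` M = Y ->
    forall U, open_in (X `*` Y) U -> M `<=` U ->
      exists V, [/\ open_in (X `*` Y) V, connected V, M `<=` V & V `<=` U].

(* Main.v *)
(* Fix a point s of S and let phi : R -> S be the leaf through s, on which the
   i-th coordinate has period N i = n 0 * ... * n (i-1).  By compactness U
   contains the part of [0,1] x S lying over an open subset W of
   [0,1] x (n-th circle) that contains the image of M.  Let C be the connected
   component of the preimage of W in the universal cover [0,1] x R that meets
   the lift of a point of M.  By connectedness, M lies over the image of C at
   every level l >= n.  As M projects onto S, C cannot be mapped injectively to
   level n, so C is invariant under a translation by N n * d with d <> 0.  Take l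
   such that gcd (N n * d) (N m) divides N l for all m >= l, and let V be the
   preimage of the image of C at level l.  It is open, contains M, lies in U,
   and the image of C under id x phi, a connected set, is dense in it. *)
Require Import Defs.
From HB Require Import structures.
From mathcomp Require Import all_boot all_order all_algebra.
From mathcomp Require Import all_classical all_reals all_analysis.
From mathcomp Require Import ring lra zify.
Set Implicit Arguments. Unset Strict Implicit. Unset Printing Implicit Defensive.
Import Order.TTheory GRing.Theory Num.Theory.
Import numFieldTopology.Exports numFieldNormedType.Exports.
Local Open Scope classical_set_scope.
Local Open Scope ring_scope.

(** * Connectedness and relative openness *)

(** Local constancy makes both [Q] and its complement relatively open in [M], so [M] meeting [Q]
    forces [M] inside [Q]. *)
Lemma connected_locally_constant {T : topologicalType} (M : set T)
    (Q : T -> Prop) :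
  connected M ->
  (forall v, M v -> \forall v' \near v, M v' -> (Q v <-> Q v')) ->
  forall v w, M v -> M w -> Q v -> Q w.
Proof.
move=> cM locQ v w Mv Mw Qv.
suff: M `&` Q = M by move=> /seteqP[_ /(_ w Mw)[]].
apply: cM; first by exists v.
- exists (fun x => M x -> Q x)°; first exact: open_interior.
  apply/seteqP; split=> x [Mx Qx]; split=> //.
    by have := locQ x Mx; apply: filterS => y My_ My; apply/(My_ My).
  exact: interior_subset Qx Mx.
- exists (~` (fun x => M x -> ~ Q x)°); first exact/open_closedC/open_interior.
  apply/seteqP; split=> x [Mx Qx]; split=> //.
    by move=> /interior_subset; exact.
  apply: contrapT => nQx; apply: Qx.
  by have := locQ x Mx; apply: filterS => y My_ My Qy; apply/nQx/(My_ My).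
Qed.

(** In a separation of [B], the connected set [A] lies in one piece; the closure of that piece
    contains [B], hence meets the other piece. *)
Lemma connected_dense {T : topologicalType} (A B : set T) :
  connected A -> A `<=` B -> B `<=` closure A -> connected B.
Proof.
move=> cA AB BA; apply/connectedP => E [E0 EU sE].
have [b AE] : exists b, A `<=` E b.
  have := connected_subset sE (_ : A `<=` _) cA.
  by rewrite -EU => /(_ AB)[]; [exists false|exists true].
have [x Ex] := E0 (~~ b).
have Bx : B x by rewrite EU; case: (b) Ex; [left|right].
have cx : closure (E b) x by apply: closureS (BA _ Bx).
case: sE => s1 s2.
by case: b {AE} Ex cx => Ex cx; [have : set0 x by rewrite -s2|have : set0 x by rewrite -s1].
Qed.

Lemma open_inP {T : topologicalType} (X V : set T) :
  V `<=` X -> (forall v, V v -> \forall w \near v, X w -> V w) ->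
  open_in X V.
Proof.
move=> VX locV; exists (fun x => X x -> V x)°; split; first exact: open_interior.
apply/seteqP; split=> x; last by move=> [Xx /interior_subset]; exact.
by move=> Vx; split; [exact: VX|exact: locV].
Qed.

Lemma continuous_pair {T U V : topologicalType} (f : T -> U) (g : T -> V) x :
  {for x, continuous f} -> {for x, continuous g} ->
  {for x, continuous (fun y => (f y, g y))}.
Proof. by move=> cf cg; exact: (cvg_pair cf cg). Qed.

(** * The circle parametrised by angle *)

Section circle.
Context {R : realType}.
Implicit Types (t u e : R) (z : R * R).

Definition cexp t : R * R := (cos t, sin t).

Lemma circle_cexp t : circle (cexp t).
Proof. exact: cos2Dsin2. Qed.

Lemma cexpD t u : cexp (t + u) = cmul (cexp t) (cexp u).
Proof. by rewrite /cexp /cmul /= cosD sinD [in X in (_, X)]addrC. Qed.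

Lemma cpow_cexp t k : cpow (cexp t) k = cexp (k%:R * t).
Proof.
elim: k => [|k IH]; first by rewrite mul0r /cexp cos0 sin0.
by rewrite /cpow iterS -/(cpow _ _) IH -cexpD -add1n natrD mulrDl mul1r.
Qed.

Lemma cexp_periodic (j : int) t : cexp (t + j%:~R * (pi *+ 2)) = cexp t.
Proof.
have nat_case (k : nat) u : cexp (u + k%:R * (pi *+ 2)) = cexp u.
  rewrite /cexp mulr_natl (periodicn (@cosD2pi R)) (periodicn (@sinD2pi R)) //.
case: j => k; first exact: nat_case.
by rewrite NegzE mulrNz mulNr -[in RHS](subrK (k.+1%:R * (pi *+ 2)) t) nat_case.
Qed.

(** The witness is [(u - t) / (2 pi)] rounded to a nearest integer. *)
Lemma near_representative t u :
  exists j : int, `|u - j%:~R * (pi *+ 2) - t| <= pi.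
Proof.
have pi0 := @pi_gt0 R; have pi2 : 0 < (pi : R) *+ 2 by rewrite pmulrn_lgt0.
pose x := (u - t) / (pi *+ 2); exists (Num.floor (x + 1 / 2)).
have := floor_itv (x + 1 / 2); set j := Num.floor _ => /andP[j1 j2].
have xE : u - t = x * (pi *+ 2).
  by rewrite /x mulfVK// gt_eqF.
rewrite addrAC xE -mulrBl normrM (gtr0_norm pi2).
suff : `|x - j%:~R| <= 1 / 2 by nra.
rewrite rmorphD /= in j2.
by rewrite ler_norml; apply/andP; split; lra.
Qed.

Lemma cexp_eqP t u :
  cexp t = cexp u <-> exists j : int, u = t + j%:~R * (pi *+ 2).
Proof.
split=> [tu|[j ->]]; last by rewrite cexp_periodic.
have [j uj] := near_representative t u; exists j.
pose v := u - j%:~R * (pi *+ 2) - t.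
have cv : cos v = 1.
  have : cexp (v + t) = cexp t.
    by rewrite -[LHS](cexp_periodic j) tu; congr cexp; rewrite /v; lra.
  rewrite /cexp => -[ct st].
  by rewrite -[v](addrK t) cosB ct st -!expr2 cos2Dsin2.
(* Since [|v| <= pi] and [cos] is injective on [[0, pi]], [cos |v| = 1] forces [|v| = 0]. *)
suff : v = 0 by rewrite /v; lra.
apply/eqP; rewrite -normr_eq0; apply/eqP; apply: (@cos_inj R).
- by rewrite in_itv /= normr_ge0.
- by rewrite in_itv /= lexx pi_ge0.
by rewrite cos_norm cv cos0.
Qed.

Lemma circleP z : circle z -> exists t, z = cexp t.
Proof.
case: z => a b; rewrite /circle /= => ab.
have a1 : -1 <= a <= 1 by apply/andP; split; nra.
have sE : sin (acos a) = `|b|.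
  by rewrite sin_acos // -sqrtr_sqr; congr Num.sqrt; lra.
have [b0|b0] := leP 0 b.
  by exists (acos a); rewrite /cexp acosK // sE ger0_norm.
by exists (- acos a); rewrite /cexp cosN sinN acosK // sE ltr0_norm ?opprK.
Qed.

(** The inner product with [cexp t] is continuous and equals [cos (u - t)] at [cexp u]. Once [u] is
    reduced to within [pi] of [t], a lower bound [cos e] on it means [|u - t| < e]. *)
Lemma cexp_local t e : 0 < e ->
  \forall z \near cexp t, circle z -> exists2 u, `|u - t| < e & z = cexp u.
Proof.
move=> e0; have pi0 := @pi_gt0 R.
(* Cosines are compared through their monotonicity on [[0, pi]], so [e] is capped at [pi]. *)
wlog epi : e e0 / e <= pi.
  move=> H; have [|epi] := leP e pi; first exact: H.
  have := H _ pi0 (lexx _); apply: filterS => z H1 /H1[u ut zu].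
  by exists u => //; exact: lt_trans epi.
pose dot z := z.1 * cos t + z.2 * sin t.
have dotc : {for cexp t, continuous dot}.
  apply: continuousD; apply: continuousM; try exact: cst_continuous.
    exact: cvg_fst.
  exact: cvg_snd.
have dott : cos e < dot (cexp t).
  rewrite /dot /cexp /= -!expr2 cos2Dsin2 -(@cos0 R) ltr_cos //.
  - by rewrite in_itv /= lexx ltW.
  - by rewrite in_itv /= ltW.
have : \forall z \near cexp t, cos e < dot z.
  exact: (dotc _ (lt_nbhsr dott)).
apply: filterS => z dotz /circleP[u zE].
have [j uj] := near_representative t u; exists (u - j%:~R * (pi *+ 2)).
  move: dotz; rewrite /dot zE -(cexp_periodic (- j)) /cexp /= -cosB mulrNz mulNr.
  rewrite -[in X in _ < X]cos_norm ltr_cos // in_itv /= ?normr_ge0 ?uj //.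
  by rewrite ltW.
by rewrite zE -[LHS](cexp_periodic (- j)) mulrNz mulNr.
Qed.

Lemma continuous_cexp : continuous cexp.
Proof.
by move=> t; apply: continuous_pair; [exact: continuous_cos|exact: continuous_sin].
Qed.

End circle.

(* [r i y t] means that y has the same i-th coordinate as the point [phi t] of the
   leaf through s, parametrised so that the i-th coordinate of the leaf has
   period [N i]. *)
Record leaf_chart {R : realType} {T : topologicalType} (S : set T) (s : T)
    (N : nat -> nat) (phi : R -> T) (r : nat -> T -> R -> Prop) : Prop := {
  lc_dvd : forall i m, (i <= m)%N -> (N i %| N m)%N;
  lc_gt : forall i, (i < N i)%N;
  lc_total : forall i y, S y -> exists t, r i y t;
  lc_period : forall i y t u, S y -> r i y t ->
    (r i y u <-> exists j : int, u = t + (N i)%:R * j%:~R);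
  lc_local : forall i y t e, S y -> 0 < e -> r i y t ->
    \forall y' \near y, S y' -> exists2 t', `|t' - t| < e & r i y' t';
  lc_proj : forall i m y t, (i <= m)%N -> S y -> r m y t -> r i y t;
  lc_basis : forall y B, S y -> nbhs y B -> exists m t e,
    [/\ 0 < e, r m y t &
        forall y' t', S y' -> `|t' - t| < e -> r m y' t' -> B y'];
  lc_leaf : forall t, S (phi t);
  lc_leaf_coord : forall i t, r i (phi t) t;
  lc_base : forall i, r i s 0 }.

Arguments lc_dvd {R T S s N phi r} l {i m}.
Arguments lc_total {R T S s N phi r} l i {y}.
Arguments lc_period {R T S s N phi r} l {i y t u}.
Arguments lc_local {R T S s N phi r} l {i y t e}.
Arguments lc_proj {R T S s N phi r} l {i m y t}.
Arguments lc_basis {R T S s N phi r} l {y B}.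

(** * Arithmetic of the periods *)

(** The numbers [gcdn D (N m)] increase with [m] for divisibility and are bounded by [D]; [l] is a
    level at which the largest value is attained. *)
Lemma gcdn_stabilizes (N : nat -> nat) (D n : nat) : (0 < D)%N ->
  (forall i m, (i <= m)%N -> (N i %| N m)%N) ->
  exists2 l, (n <= l)%N & forall m, (l <= m)%N -> (gcdn D (N m) %| N l)%N.
Proof.
move=> D0 NN; pose P g := `[< exists2 l, (n <= l)%N & g = gcdn D (N l) >].
have exP : exists g, P g by exists (gcdn D (N n)); apply/asboolP; exists n.
have bP g : P g -> (g <= D)%N.
  by move=> /asboolP[l _ ->]; apply: dvdn_leq => //; exact: dvdn_gcdl.
case: (ex_maxnP exP bP) => _ /asboolP[l nl ->] lmax; exists l => // m lm.
have gm : (gcdn D (N m) <= gcdn D (N l))%N.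
  by apply: lmax; apply/asboolP; exists m => //; exact: leq_trans lm.
have gl : (gcdn D (N l) %| gcdn D (N m))%N.
  by rewrite dvdn_gcd dvdn_gcdl (dvdn_trans (dvdn_gcdr _ _)) ?NN.
suff -> : gcdn D (N m) = gcdn D (N l) by exact: dvdn_gcdr.
apply/eqP; rewrite eqn_leq gm dvdn_leq // gcdn_gt0 D0 //.
Qed.

Lemma dvdn_gcd_Bezout (a b c : nat) (k : int) : (gcdn a b %| c)%N ->
  exists i j : int, c%:Z * k = a%:Z * i + b%:Z * j.
Proof.
move=> /dvdnP[q ->]; have [u [v uv]] := Bezoutz a%:Z b%:Z.
exists (u * q%:Z * k), (v * q%:Z * k).
rewrite /gcdz /= in uv.
rewrite PoszM -uv; ring.
Qed.

(** * Components in the universal cover and the strips below them *)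

Section leaf.
Context {R : realType} {T : topologicalType} {S : set T} {s : T}
  {N : nat -> nat} {phi : R -> T} {r : nat -> T -> R -> Prop}.
Hypothesis chart : leaf_chart S s N phi r.
Variable U : set (R * T).
Implicit Types (z : R * R) (v : R * T) (k j : int).

Let X : set R := [set x | 0 <= x <= 1].

(* The points of the universal cover of [0,1] x (n-th circle) over which, locally,
   all of [0,1] x S lies in U. *)
Definition sheet n : set (R * R) := [set z | X z.1 /\
  \forall z' \near z, X z'.1 -> forall y, S y -> r n y z'.2 -> U (z'.1, y)].

Lemma sheet_open n z : sheet n z ->
  \forall z' \near z, X z'.1 -> sheet n z'.
Proof. by move=> [_ /nbhs_interior]; apply: filterS => z' ? ?; split. Qed.

(** The segment from [z] to a nearby [z'] stays in a ball and in [[0,1] x R], hence in the sheet. So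
    components of the sheet are relatively open. *)
Lemma sheet_component n z : sheet n z ->
  \forall z' \near z, X z'.1 -> connected_component (sheet n) z z'.
Proof.
move=> sz; have /nbhs_ballP[e /= e0 esub] := sheet_open sz.
apply/nbhs_ballP; exists e => //= z' [b1 b2] Xz'.
pose f (l : R) : R * R := (z.1 + l * (z'.1 - z.1), z.2 + l * (z'.2 - z.2)).
have in01 (l : R) : l \in `[0, 1] -> 0 <= l <= 1 by rewrite in_itv.
exists (f @` `[0, 1]); last first.
  exists 1 => /=; first by rewrite in_itv /= lexx ler01.
  by rewrite /f !mul1r !subrKC; case: (z').
split.
- exists 0 => /=; first by rewrite in_itv /= lexx ler01.
  by rewrite /f !mul0r !addr0; case: (z).
- move=> _ [l /in01 /andP[l0 l1] <-].
  have small (a b : R) : `|a - b| < e -> `|a - (a + l * (b - a))| < e.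
    move=> ab; rewrite opprD addNKr normrN normrM ger0_norm // distrC.
    by apply: le_lt_trans ab; rewrite ler_piMl.
  apply: esub; first by split; exact: small.
  by case: sz Xz' => + _; rewrite /X /= => /andP[? ?] /andP[? ?]; nra.
- apply: connected_continuous_connected; first exact: segment_connected.
  apply: continuous_subspaceT => l.
  have cf (a b : R) : {for l : R, continuous (fun l : R => a + l * (b - a))}.
    apply: continuousD; first exact: cst_continuous.
    by apply: continuousM; [exact: cvg_id|exact: cst_continuous].
  exact: continuous_pair (cf _ _) (cf _ _).
Qed.

(** These are the deck transformations of the universal cover over level [n]. *)
Let shift n k z : R * R := (z.1, z.2 + (N n)%:R * k%:~R).

Let shift_continuous n k : continuous (shift n k).
Proof.
move=> z.
have c1 : {for z, continuous (fst : R * R -> R)} by exact: cvg_fst.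
have c2 : {for z, continuous (fun z : R * R => z.2 + (N n)%:R * k%:~R)}.
  by apply: continuousD; [exact: cvg_snd|exact: cst_continuous].
exact: continuous_pair c1 c2.
Qed.

Let shiftK n k z : shift n (- k) (shift n k z) = z.
Proof. by rewrite /shift /= mulrNz mulrN addrK; case: z. Qed.

Lemma sheet_shift n k z : sheet n z -> sheet n (shift n k z).
Proof.
move=> [Xz near_z]; split => //.
pose P z' := X z'.1 -> forall y, S y -> r n y z'.2 -> U (z'.1, y).
have : nbhs (shift n k z) (shift n (- k) @^-1` P).
  by apply: shift_continuous; rewrite shiftK.
apply: filterS => z' /= near_z' Xz' y Sy ry; apply: near_z' => //.
by apply/(lc_period chart Sy ry); exists (- k).
Qed.

Lemma component_shift n k z z' : connected_component (sheet n) z z' ->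
  connected_component (sheet n) (shift n k z) (shift n k z').
Proof.
move=> [B [Bz Bsub cB] Bz']; exists (shift n k @` B); last by exists z'.
split; first by exists z.
  by move=> _ [w /Bsub Bw <-]; exact: sheet_shift.
apply: connected_continuous_connected => //.
exact: continuous_subspaceT (@shift_continuous n k).
Qed.

(** The component is always taken in [sheet n], but its points are read at level [l]: a larger [l]
    separates lifts that differ by a multiple of [N n] but not of [N l]. *)
Definition strip n l z0 : set (R * T) := [set v |
  exists2 t, r l v.2 t & connected_component (sheet n) z0 (v.1, t)].

(** The lift [u] of [v] witnessing membership differs from [t] by a multiple of [N l], hence of
    [N n]; the deck transformation by that amount carries the link from [t] to [t'] over to [u]. *)
Lemma strip_transfer n l z0 v v' t t' : (n <= l)%N -> S v.2 -> S v'.2 ->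
  r l v.2 t -> r l v'.2 t' ->
  connected_component (sheet n) (v.1, t) (v'.1, t') ->
  strip n l z0 v -> strip n l z0 v'.
Proof.
move=> nl Sv Sv' rt rt' tt' [u ru Cu].
have /(lc_period chart Sv rt)[j uE] := ru.
have [q NE] := dvdnP (lc_dvd chart nl).
exists (t' + (N l)%:R * j%:~R); first by apply/(lc_period chart Sv' rt'); exists j.
apply: connected_component_trans Cu _.
have := component_shift (q%:Z * j) tt'; rewrite /shift /=.
suff -> : (N n)%:R * (q%:Z * j)%:~R = (N l)%:R * j%:~R :> R by rewrite uE.
by rewrite NE natrM intrM -pmulrn; ring.
Qed.

Definition covered n : set (R * T) := [set v |
  forall t, r n v.2 t -> sheet n (v.1, t)].

Lemma strip_near n l v t : (n <= l)%N -> S v.2 -> sheet n (v.1, t) ->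
  r l v.2 t -> \forall v' \near v, X v'.1 -> S v'.2 ->
  exists2 t', `|t' - t| < 1 & r l v'.2 t' /\
   connected_component (sheet n) (v.1, t) (v'.1, t').
Proof.
move=> nl Sv st rt; have /nbhs_ballP[e /= e0 esub] := sheet_component st.
pose d := Num.min 1 e; have d0 : 0 < d by rewrite lt_min ltr01 e0.
have near2 := lc_local chart Sv d0 rt.
exists (ball v.1 e, [set y' | S y' -> exists2 t', `|t' - t| < d & r l y' t']).
  by split; first exact: nbhsx_ballx.
move=> v' /= [b1 b2] Xv' /b2[t']; rewrite lt_min => /andP[t1 te] rt'.
exists t' => //; split=> //; apply: esub => //; split=> //=.
by rewrite /ball /= distrC.
Qed.

(** Over a covered point the lift lies in the sheet whether or not it lies in the chosen component,
    so membership transfers in both directions. *)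
Lemma strip_locally_constant n l z0 v : (n <= l)%N -> S v.2 ->
  covered n v -> \forall v' \near v, X v'.1 -> S v'.2 ->
  (strip n l z0 v <-> strip n l z0 v').
Proof.
move=> nl Sv cv; have [t rt] := lc_total chart l Sv.
have st := cv _ (lc_proj chart nl Sv rt).
have := strip_near nl Sv st rt; apply: filterS => v' H Xv' Sv'.
have [t' _ [rt' tt']] := H Xv' Sv'.
split; first exact: (strip_transfer nl Sv Sv' rt rt').
apply: (strip_transfer nl Sv' Sv rt' rt).
exact: connected_component_sym.
Qed.

(** Each point of [M] has a basic neighbourhood described at a single level [m], and every level
    above [m] serves as well; compactness yields one level for all of [M]. *)
Lemma compact_covered (M : set (R * T)) : compact M -> M `<=` X `*` S ->
  open_in (X `*` S) U -> M `<=` U -> exists n, M `<=` covered n.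
Proof.
move=> cM MXS [W [oW UE]] MU.
suff : \forall n \near \oo, M `<=` covered n by move=> [n _ /(_ n (leqnn n))]; exists n.
apply: (iffRL (near_covering_withinP M) (iffLR (compact_near_coveringP M) cM)).
move=> [x y] Mxy; have [Xx Sy] := MXS _ Mxy.
have : nbhs (x, y) W by apply: open_nbhs_nbhs; split=> //; have := MU _ Mxy; rewrite UE => -[].
move=> [[/= A B] [nA nB] ABW].
have [m [t [e [e0 rt tB]]]] := lc_basis chart Sy nB.
(* One half of [e] is for moving the point of [M], the other for the ball around its lift in the
   universal cover. *)
have e2 : 0 < e / 2 by rewrite divr_gt0.
have nearS := lc_local chart Sy e2 rt.
have near1 : \forall v \near (x, y), nbhs v.1 A.
  exists (A°, setT) => [|v []] //; split; last exact: filterT.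
  exact: nbhs_interior.
have near2 : \forall v \near (x, y), S v.2 ->
    exists2 t', `|t' - t| < e / 2 & r m v.2 t'.
  by eexists (setT, _) => [|v [_]]; [split; [exact: filterT|exact: nearS]|exact].
near=> v n => Mv z rz; have nAv : nbhs v.1 A by near: v.
have nSv : S v.2 -> exists2 t', `|t' - t| < e / 2 & r m v.2 t' by near: v.
have [Xv Sv] := MXS _ Mv.
have mn : (m <= n)%N by near: n; exists m.
have [t' tt' rt'] := nSv Sv.
have [j zE] : exists j : int, z = t' + (N m)%:R * j%:~R.
  by apply/(lc_period chart Sv rt'); exact: (lc_proj chart mn).
split=> //.
exists (A, ball z (e / 2)) => /=; first by split; [exact: nAv|exact: nbhsx_ballx].
move=> [x' z'] /= [Ax' zz'] Xx' y' Sy' ry'; rewrite UE; split=> //.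
apply: ABW; split=> //=.
have ry'm := lc_proj chart mn Sy' ry'.
have ry'j : r m y' (z' - (N m)%:R * j%:~R).
  by apply/(lc_period chart Sy' ry'm); exists (- j); rewrite mulrNz mulrN.
apply: tB ry'j => //.
move: zz'; rewrite /ball /= zE => zz'.
have -> : z' - (N m)%:R * j%:~R - t =
  (t' - t) - (t' + (N m)%:R * j%:~R - z') by ring.
by apply: le_lt_trans (ler_normB _ _) _; lra.
Unshelve. all: by end_near.
Qed.

Lemma leaf_continuous : continuous phi.
Proof.
move=> t B nB; have [m [t0 [e [e0 rt0 tB]]]] := lc_basis chart (lc_leaf chart t) nB.
have [j tE] := iffLR (lc_period chart (lc_leaf chart t) rt0) (lc_leaf_coord chart m t).
suff : nbhs (t : R) (phi @^-1` B) by [].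
apply: filterS (nbhsx_ballx (t : R) _ e0) => u; rewrite /ball /= => ut.
apply: (tB _ (u - (N m)%:R * j%:~R)); first exact: (lc_leaf chart).
  by rewrite (_ : _ - t0 = - (t - u)) ?normrN // tE; ring.
apply/(lc_period chart (lc_leaf chart u) (lc_leaf_coord chart m u)).
by exists (- j); rewrite mulrNz mulrN.
Qed.

(** A deck transformation permutes the components of the sheet, so one that keeps a single point [w]
    in the component preserves the whole component, as do its iterates and inverses. *)
Lemma component_periodic n d z0 w z k :
  connected_component (sheet n) z0 w ->
  connected_component (sheet n) z0 (shift n d w) ->
  connected_component (sheet n) z0 z ->
  connected_component (sheet n) z0 (shift n (d * k) z).
Proof.
move=> Cw Cdw.
have shiftD i j u : shift n i (shift n j u) = shift n (i + j) u.
  by rewrite /shift /=; congr pair; rewrite intrD; ring.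
have up u : connected_component (sheet n) z0 u ->
    connected_component (sheet n) u (shift n d u).
  move=> Cu; apply: (connected_component_trans (y := shift n d w)).
    by apply: connected_component_trans Cdw; exact: connected_component_sym.
  apply: component_shift.
  exact: connected_component_trans (connected_component_sym Cw) Cu.
have down u : connected_component (sheet n) z0 u ->
    connected_component (sheet n) u (shift n (- d) u).
  move=> Cu; have := component_shift (- d) (up _ Cu).
  by rewrite shiftK; exact: connected_component_sym.
have shift0 u : shift n 0 u = u by case: u => a b; rewrite /shift mulr0 addr0.
case: k => i; rewrite ?NegzE ?mulrN -?mulNr.
  elim: i z => [|i IH] z Cz; first by rewrite mulr0 shift0.
  rewrite -addn1 PoszD mulrDr mulr1 -shiftD; apply: IH.
  exact: connected_component_trans (up _ Cz).
move: (i.+1) => {}i; elim: i z => [|i IH] z Cz; first by rewrite mulr0 shift0.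
rewrite -addn1 PoszD mulrDr mulr1 -shiftD; apply: IH.
exact: connected_component_trans (down _ Cz).
Qed.

(** Near a point with lift [t], lifts can be chosen of size below [|t| + 1]; compactness makes the
    bound uniform. *)
Lemma strip_bounded (M : set (R * T)) n z0 : compact M -> M `<=` X `*` S ->
  M `<=` covered n -> M `<=` strip n n z0 ->
  exists K : nat, M `<=` [set v | exists t, [/\ `|t| < K%:R, r n v.2 t &
    connected_component (sheet n) z0 (v.1, t)]].
Proof.
move=> cM MXS cov Mstrip.
suff : \forall K \near \oo, M `<=` [set v | exists t,
    [/\ `|t| < (K : nat)%:R, r n v.2 t &
     connected_component (sheet n) z0 (v.1, t)]].
  by move=> [K _ /(_ K (leqnn K))]; exists K.
apply: (iffRL (near_covering_withinP M) (iffLR (compact_near_coveringP M) cM)).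
move=> v Mv; have [Xv Sv] := MXS _ Mv; have [t rt Ct] := Mstrip _ Mv.
have near_v := strip_near (leqnn n) Sv (cov _ Mv _ rt) rt.
near=> w K => Mw; have [Xw Sw] := MXS _ Mw.
have [||t' t't [rt' tt']] : X w.1 -> S w.2 -> exists2 t', `|t' - t| < 1 &
    r n w.2 t' /\ connected_component (sheet n) (v.1, t) (w.1, t').
- by near: w.
- exact: Xw.
- exact: Sw.
exists t'; split=> //; last exact: connected_component_trans tt'.
have : `|t| + 1 <= K%:R by near: K; exact: nbhs_infty_ger.
have := ler_normD (t' - t) t; rewrite subrK; lra.
Unshelve. all: by end_near.
Qed.

(* If the component did not return to itself, its level-l lifts of points of M
   would stay within distance K of 0, so M would miss the point at time N l / 2
   of a circle of length N l > 2 K. *)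
Lemma strip_winds (M : set (R * T)) n z0 : compact M -> M `<=` X `*` S ->
  snd @` M = S -> M `<=` covered n ->
  (forall l, (n <= l)%N -> M `<=` strip n l z0) ->
  exists z d, [/\ d != 0, connected_component (sheet n) z0 z &
    connected_component (sheet n) z0 (shift n d z)].
Proof.
move=> cM MXS sM cov Mstrip.
have [K MK] := strip_bounded cM MXS cov (Mstrip _ (leqnn n)).
pose l := maxn n K.*2; have nl : (n <= l)%N by rewrite leq_maxl.
pose a : R := (N l)%:R / 2.
have : S (phi a) by exact: (lc_leaf chart).
rewrite -sM => -[[x y] Mv /= yE].
have Sy : S y by rewrite yE; exact: (lc_leaf chart).
have [u /= ru Cu] := Mstrip _ nl _ Mv.
have [t /= [tK rt Ct]] := MK _ Mv.
have ra : r l y a by rewrite yE; exact: (lc_leaf_coord chart).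
have [i uE] := iffLR (lc_period chart Sy ra) ru.
have [j ut] := iffLR (lc_period chart Sy rt) (lc_proj chart nl Sy ru).
exists (x, t), j; split=> //; last by rewrite /shift /= -ut.
apply/eqP => j0; move: ut; rewrite j0 mulr0 addr0 => utE.
have KN : 2 * K%:R < (N l)%:R :> R.
  rewrite -natrM ltr_nat mul2n (leq_ltn_trans _ (lc_gt chart l)) //.
  by rewrite leq_maxr.
have : `|u| < (N l)%:R / 2 by rewrite utE; lra.
rewrite uE /a; set b := (N l)%:R : R.
(* Every level-[l] lift of [phi a] is an odd multiple of half the period, so its absolute value is
   at least [N l / 2]. *)
have -> : b / 2 + b * i%:~R = b / 2 * (2 * i + 1)%:~R.
  by rewrite intrD intrM; field.
have b0 : 0 < b by rewrite ltr0n (leq_ltn_trans _ (lc_gt chart l)).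
rewrite normrM gtr0_norm ?divr_gt0 // gtr_pMr ?divr_gt0 //.
rewrite -intr_norm ltrz1; lia.
Qed.

Lemma strip_open n l z0 : (n <= l)%N -> open_in (X `*` S) (X `*` S `&` strip n l z0).
Proof.
move=> nl; apply: open_inP => [v []//|v [[Xv Sv] [t rt Ct]]].
have := strip_near nl Sv (connected_component_sub Ct) rt.
apply: filterS => w H [Xw Sw]; split=> //; have [t' _ [rt' tt']] := H Xw Sw.
by exists t' => //; exact: connected_component_trans tt'.
Qed.

Lemma strip_sub n l z0 : (n <= l)%N -> X `*` S `&` strip n l z0 `<=` U.
Proof.
move=> nl [x y] [[/= Xx Sy] [t rt /connected_component_sub[_ /nbhs_singleton]]].
by move=> /(_ Xx y Sy (lc_proj chart nl Sy rt)).
Qed.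

Lemma strip_connected n l z0 z d : (n <= l)%N ->
  connected_component (sheet n) z0 z ->
  connected_component (sheet n) z0 (shift n d z) ->
  (forall m, (l <= m)%N -> (gcdn (N n * `|d|) (N m) %| N l)%N) ->
  connected (X `*` S `&` strip n l z0).
Proof.
move=> nl Cz Cdz gcdN.
pose f (w : R * R) : R * T := (w.1, phi w.2).
apply: (@connected_dense _ (f @` connected_component (sheet n) z0)).
- apply: connected_continuous_connected; first exact: component_connected.
  apply: continuous_subspaceT => w.
  have c1 : {for w, continuous (fst : R * R -> R)} by exact: cvg_fst.
  have c2 : {for w, continuous (phi \o (snd : R * R -> R))}.
    by apply: continuous_comp; [exact: cvg_snd|exact: leaf_continuous].
  exact: continuous_pair c1 c2.
- move=> _ [w Cw <-]; split.
    by split; [case: (connected_component_sub Cw)|exact: (lc_leaf chart)].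
  by exists w.2; [exact: (lc_leaf_coord chart)|case: (w) Cw].
(* The component is dense in the strip: since gcd (N n * d) (N m') divides N l,
   translating t by a multiple of N n * d turns agreement of y with [phi t] at
   level l into agreement at level m'. *)
- move=> [x y] [[/= Xx Sy] [t /= rt Ct]] W [[/= A B] [nA nB] ABW].
  have [m [t0 [e [e0 rt0 tB]]]] := lc_basis chart Sy nB.
  (* Level [m'] refines both the level [m] of the basic neighbourhood and the level [l] of the
     strip. *)
  pose m' := maxn m l.
  have [u ru] := lc_total chart m' Sy.
  have [i uE] := iffLR (lc_period chart Sy rt)
    (lc_proj chart (leq_maxr m l) Sy ru).
  have [a [b abE]] := dvdn_gcd_Bezout i (gcdN _ (leq_maxr m l)).
  (* By the Bezout identity, [t'] equals [u - N m' * b], so it is again a level-[m'] lift of [y]. *)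
  pose t' := t + (N n)%:R * (`|d|%:Z * a)%:~R.
  have Ct' : connected_component (sheet n) z0 (x, t').
    (* The gcd involves [|d|], while the component is known to be invariant under [d]; the sign goes
       into [k]. *)
    have [k kE] : exists k, `|d|%:Z * a = d * k.
      case: (leP 0 d) => d0; [exists a|exists (- a)]; rewrite abszE.
        by rewrite ger0_norm.
      by rewrite ltr0_norm // mulrN mulNr.
    by rewrite /t' kE; exact: component_periodic Cz Cdz Ct.
  exists (x, phi t'); split; first by exists (x, t').
  apply: ABW; split=> /=; first exact: nbhs_singleton.
  have rum : r m' y t'.
    apply/(lc_period chart Sy ru); exists (- b).
    have := congr1 (fun c : int => c%:~R : R) abE.
    rewrite /t' uE intrD !intrM PoszM intrM mulrNz -!pmulrn; lra.
  have rm := lc_proj chart (leq_maxl m l) Sy rum.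
  have [k t0E] := iffLR (lc_period chart Sy rm) rt0.
  apply: (tB _ t0); first exact: (lc_leaf chart).
    by rewrite subrr normr0.
  apply/(lc_period chart (lc_leaf chart t') (lc_leaf_coord chart m t')).
  by exists k.
Qed.

Lemma leaf_fupcon (M : set (R * T)) x0 : M (x0, s) -> M `<=` X `*` S ->
  compact M -> connected M -> snd @` M = S -> open_in (X `*` S) U -> M `<=` U ->
  exists V, [/\ open_in (X `*` S) V, connected V, M `<=` V & V `<=` U].
Proof.
move=> Mx0 MXS cM conM sM oU MU.
have [n cov] := compact_covered cM MXS oU MU.
(* The point [s] has parameter 0 at every level, so this one base point serves all levels [l] at
   once. *)
pose z0 : R * R := (x0, 0).
have Mstrip l : (n <= l)%N -> M `<=` strip n l z0.
  move=> nl v Mv; apply: (connected_locally_constant conM _ Mx0 Mv).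
    move=> w Mw; have [Xw Sw] := MXS _ Mw.
    have := strip_locally_constant z0 nl Sw (cov _ Mw).
    by apply: filterS => w' H Mw'; have [? ?] := MXS _ Mw'; exact: H.
  exists 0; first exact: (lc_base chart).
  apply: connected_component_refl; apply: cov Mx0 _ _.
  exact: (lc_base chart).
have [z [d [d0 Cz Cdz]]] := strip_winds cM MXS sM cov Mstrip.
have [|l nl gcdN] := @gcdn_stabilizes N (N n * `|d|) n _ (@lc_dvd _ _ _ _ _ _ _ chart).
  by rewrite muln_gt0 absz_gt0 d0 (leq_ltn_trans _ (lc_gt chart n)).
exists (X `*` S `&` strip n l z0); split.
- exact: strip_open.
- exact: strip_connected Cz Cdz gcdN.
- by move=> v Mv; split; [exact: MXS|exact: Mstrip].
- exact: strip_sub.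
Qed.

End leaf.

(** * The leaf and its chart in an inverse limit of circles *)

Section solenoid.
Context {R : realType} {n : nat -> nat}.
Hypothesis n_ge2 : forall i, (2 <= n i)%N.
Implicit Types (t u e : R).

Definition winding i := (\prod_(j < i) n j)%N.

Lemma windingS i : winding i.+1 = (winding i * n i)%N.
Proof. exact: big_ord_recr. Qed.

Lemma winding_gt i : (i < winding i)%N.
Proof.
elim: i => [|i IH]; first by rewrite /winding big_ord0.
by rewrite windingS; have := n_ge2 i; nia.
Qed.

Lemma winding_dvd i m : (i <= m)%N -> (winding i %| winding m)%N.
Proof.
elim: m => [|m IH]; first by rewrite leqn0 => /eqP ->.
rewrite leq_eqVlt => /predU1P[->//|/IH im].
by rewrite windingS dvdn_mulr.
Qed.

Let L := @solenoid_invlim R n.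
Variable theta : nat -> R.
Hypothesis Ltheta : L (fun i => cexp (theta i)).

(** The angle [theta i] is the position of the base point on circle [i]. Time is scaled so that one
    turn of circle [i] takes [winding i] units, which makes the coordinates compatible with the
    bonding maps. *)
Definition leaf_coord i t : R * R :=
  cexp (theta i + t * (pi *+ 2) / (winding i)%:R).

Let W0 i : 0 < (winding i)%:R :> R.
Proof. by rewrite ltr0n (leq_ltn_trans _ (winding_gt i)). Qed.

Let pi2 : 0 < (pi : R) *+ 2. Proof. by rewrite pmulrn_lgt0 // pi_gt0. Qed.

Lemma leaf_coordS i t : cpow (leaf_coord i.+1 t) (n i) = leaf_coord i t.
Proof.
have [_ thetaE] := Ltheta i.
rewrite /leaf_coord cpow_cexp mulrDr !cexpD -cpow_cexp -thetaE.
congr (cmul _ (cexp _)); rewrite windingS natrM.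
have n0 : 0 < (n i)%:R :> R by rewrite ltr0n; have := n_ge2 i; lia.
have := W0 i; move: (pi *+ 2) (winding i)%:R => P w w0.
by field; rewrite !gt_eqF.
Qed.

Lemma leaf_coord_invlim t : L (leaf_coord^~ t).
Proof. by move=> i; split; [exact: circle_cexp|rewrite leaf_coordS]. Qed.

Lemma leaf_coord_eqP i t u : leaf_coord i t = leaf_coord i u <->
  exists j : int, u = t + (winding i)%:R * j%:~R.
Proof.
have := W0 i; rewrite /leaf_coord; move: (winding i)%:R => w w0.
split=> [/cexp_eqP[j uE]|[j ->]]; last (apply/cexp_eqP; exists j).
  exists j; move: uE; rewrite -addrA => /addrI uE.
  apply: (mulIf (lt0r_neq0 pi2)); apply: (mulIf (invr_neq0 (lt0r_neq0 w0))).
  by rewrite uE; field; rewrite gt_eqF.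
by field; rewrite gt_eqF.
Qed.

Lemma leaf_coord_local i t e : 0 < e -> \forall z \near leaf_coord i t,
  circle z -> exists2 u, `|u - t| < e & z = leaf_coord i u.
Proof.
move=> e0; have w0 := W0 i.
have e'0 : 0 < e * (pi *+ 2) / (winding i)%:R by rewrite divr_gt0 // mulr_gt0.
have := cexp_local (theta i + t * (pi *+ 2) / (winding i)%:R) e'0.
apply: filterS => z H /H[u ut zE].
exists ((u - theta i) * (winding i)%:R / (pi *+ 2)); last first.
  rewrite zE /leaf_coord; congr cexp.
  move: pi2 w0; move: (pi *+ 2) (winding i)%:R => P w P0 w0.
  by field; rewrite !gt_eqF.
move: ut pi2 w0; move: (pi *+ 2) (winding i)%:R => P w ut P0 w0.
rewrite -(ltr_pM2r P0) -(ltr_pM2r (_ : 0 < w^-1)) ?invr_gt0 //.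
apply: le_lt_trans ut.
rewrite -[X in _ * X / _](gtr0_norm P0) -[X in _ / X](gtr0_norm w0).
rewrite -normfV -!normrM le_eqVlt; apply/orP; left; apply/eqP; congr `|_|.
by field; rewrite !gt_eqF.
Qed.

Lemma leaf_coord_onto i z : circle z -> exists t, z = leaf_coord i t.
Proof.
move=> /circleP[u ->]; exists ((u - theta i) * (winding i)%:R / (pi *+ 2)).
rewrite /leaf_coord; congr cexp; have := W0 i.
move: pi2; move: (pi *+ 2) (winding i)%:R => P w P0 w0.
by field; rewrite !gt_eqF.
Qed.

Lemma continuous_leaf_coord i : continuous (leaf_coord i).
Proof.
move=> t; pose h u := theta i + u * (pi *+ 2) / (winding i)%:R.
have ch : {for t, continuous h}.
  apply: continuousD; first exact: cst_continuous.
  apply: continuousM; last exact: cst_continuous.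
  by apply: continuousM; [exact: cvg_id|exact: cst_continuous].
exact: continuous_comp ch (@continuous_cexp R (h t)).
Qed.

Lemma leaf_coord_proj (w : {ptws nat -> (R * R)%type}) i m t : L w ->
  (i <= m)%N -> w m = leaf_coord m t -> w i = leaf_coord i t.
Proof.
move=> Lw; elim: m => [|m IH]; first by rewrite leqn0 => /eqP ->.
rewrite leq_eqVlt => /predU1P[->//|im] wm; apply: IH => //.
by have [_ ->] := Lw m; rewrite wm leaf_coordS.
Qed.

(** The sets [A] restrict one coordinate only, yet form a filter base, because a coordinate of
    higher index determines all lower ones. This filter converges to [z] coordinatewise, hence
    pointwise. *)
Lemma invlim_basis (z : {ptws nat -> (R * R)%type}) (B : set _) :
  L z -> nbhs z B -> exists m t e, [/\ 0 < e, z m = leaf_coord m t &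
    forall w u, L w -> `|u - t| < e -> w m = leaf_coord m u -> B w].
Proof.
move=> Lz nB.
have /choice[a aE] : forall i, exists t, z i = leaf_coord i t.
  by move=> i; apply: leaf_coord_onto; have [] := Lz i.
pose A (me : nat * R) : set {ptws nat -> (R * R)%type} :=
  [set w | L w /\ exists2 u, `|u - a me.1| < me.2 & w me.1 = leaf_coord me.1 u].
pose F := filter_from [set me : nat * R | 0 < me.2] A.
have FF : Filter F.
  apply: filter_from_filter; first by exists (0%N, 1) => /=.
  move=> [i d] [j e] /= d0 e0; pose m := maxn i j.
  (* The lifts [a i] are chosen independently, so [a m] and [a k] agree only up to a multiple of
     [winding k], which is subtracted from [u]. *)
  have down k c u w : (k <= m)%N -> L w -> `|u - a m| < c ->
      w m = leaf_coord m u ->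
      exists2 u, `|u - a k| < c & w k = leaf_coord k u.
    move=> km Lw uc wm.
    have [l lE] : exists l : int, a m = a k + (winding k)%:R * l%:~R.
      apply/leaf_coord_eqP; rewrite -aE.
      exact: (leaf_coord_proj Lz km (aE m)).
    exists (u - (winding k)%:R * l%:~R); first by move: uc; rewrite lE opprD addrA addrAC.
    rewrite (leaf_coord_proj Lw km wm); apply/leaf_coord_eqP.
    by exists (- l); rewrite mulrNz mulrN.
  exists (m, Num.min d e) => /=; first by rewrite lt_min d0 e0.
  move=> w [Lw [u /=]]; rewrite lt_min => /andP[ud ue] wm.
  by split; split=> //; apply: down wm => //; rewrite ?leq_maxl ?leq_maxr.
have Fz : F --> z.
  apply/cvg_sup => i V [V'] [[W] oW <-] Wz WV.
  have : nbhs (a i) (leaf_coord i @^-1` W).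
    apply: continuous_leaf_coord; rewrite -aE.
    by apply: open_nbhs_nbhs.
  move=> /nbhs_ballP[e /= e0 eW]; exists (i, e) => //= w [Lw [u ut wu]].
  apply: WV => /=; rewrite /= wu; apply: eW.
  by rewrite /ball /= distrC.
have [[m e] /= e0 AB] := Fz _ nB.
exists m, (a m), e; split=> // w u Lw ue wu; apply: AB; split=> //.
by exists u.
Qed.

End solenoid.

(** The chart of the inverse limit is transported along the homeomorphism: coordinates of [y] are
    read off [f y], and the leaf is mapped back by [g]. *)
Lemma solenoid_leaf_chart (R : realType) (T : topologicalType) (S : set T) s :
  is_solenoid R S -> S s -> exists N (phi : R -> T) r, leaf_chart S s N phi r.
Proof.
move=> [n [n2 [f [g [cf cg fSL gLS [gf fg]]]]]] Ss.
have Lf y : S y -> @solenoid_invlim R n (f y) by move=> Sy; apply: fSL; exists y.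
have /choice[theta fs] : forall i, exists t : R, f s i = cexp t.
  by move=> i; apply: circleP; have [] := Lf s Ss i.
have fsE : f s = (fun i => cexp (theta i)) by apply/funext.
have Lt : @solenoid_invlim R n (fun i => cexp (theta i)) by rewrite -fsE; exact: Lf.
pose q := @leaf_coord R n theta.
have Lq t := leaf_coord_invlim n2 Lt t.
exists (@winding n), (fun t => g (q^~ t)), (fun i y t => f y i = q i t); split.
- exact: winding_dvd.
- exact: winding_gt.
- move=> i y Sy; apply: leaf_coord_onto => //.
  by have [] := Lf y Sy i.
- move=> i y t u Sy ->; exact: leaf_coord_eqP.
- move=> i y t e Sy e0 fy.
  pose Q z := circle z -> exists2 u, `|u - t| < e & z = q i u.
  have nQ : nbhs (f y i) Q by rewrite fy; exact: leaf_coord_local.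
  have : within S (nbhs y) (f @^-1` (proj i @^-1` Q)).
    move/subspace_continuousP : cf => /(_ y Sy); apply.
    exact: (@proj_continuous nat (fun=> (R * R)%type) i (f y) Q nQ).
  rewrite /within /=; apply: filterS => y' H Sy'; apply: H => //.
  by have [] := Lf y' Sy' i.
- move=> i m y t im Sy; exact: leaf_coord_proj (Lf y Sy) im.
- move=> y B Sy nB.
  have ngB : nbhs (g (f y)) B by rewrite gf.
  have : within (@solenoid_invlim R n) (nbhs (f y)) (g @^-1` B).
    by move/subspace_continuousP : cg => /(_ (f y) (Lf y Sy)); apply.
  rewrite /within /= => /(invlim_basis n2 Lt (Lf y Sy))[m [t [e [e0 ft H]]]].
  exists m, t, e; split=> // y' u Sy' ut fu.
  by rewrite -(gf y' Sy'); apply: (H _ u) => //; exact: Lf.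
- by move=> t; apply: gLS; exists (q^~ t).
- by move=> i t; rewrite fg.
- by move=> i; rewrite fs /q /leaf_coord !mul0r addr0.
Qed.

Theorem theorem1 (R : realType) (T : topologicalType) (S : set T) :
  is_solenoid R S ->
  fupcon [set x : R | 0 <= x <= 1] S.
Proof.
move=> solS M MXS [[[x0 s] Mx0] cM conM] _ sM U oU MU.
have [_ /= Ss] := MXS _ Mx0.
have [N [phi [r chart]]] := solenoid_leaf_chart solS Ss.
exact: (leaf_fupcon chart Mx0 MXS cM conM sM oU MU).
Qed.
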